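(* Let $p\neq2$ be a prime, let $F$ be a finite field extension of $\mathbb{Q}_p$, let $a\in F^*/(F^* )^2$, and let $$H_{\theta_a}=\left\{\begin{pmatrix} x&y\\ ay&x\end{pmatrix}\in\mathrm{SL}(2,F)\ \middle|\ x^2-ay^2=1\right\}$$ be the fixed point group of the involution $\theta_a:g\mapsto AgA^{-1}$ of $\mathrm{SL}(2,F)$, where $A=\begin{pmatrix}0&1\\ a&0\end{pmatrix}$. Then any Chabauty limit of $H_{\theta_a}$ inside $\mathrm{SL}(2,F)$ is $\mathrm{SL}(2,F)$-conjugate either to $H_{\theta_a}$, or to the subgroup $$\left\{\mu\begin{pmatrix}1&x\\0&1\end{pmatrix}\ \middle|\ x\in F,\ \mu\in\mu_2\right\}$$ of the Borel subgroup $B_F^{+}\leq\mathrm{SL}(2,F)$, where $\mu_2$ is the group of $2$nd roots of unity in $F$.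
   Context: For a locally compact group $G$, the set $\mathcal{S}(G)$ of closed subgroups carries the Chabauty topology; for $G$ metrizable, $H_n\to H$ in $\mathcal{S}(G)$ iff (1) every $h\in H$ is the limit of some sequence $h_n\in H_n$, and (2) whenever $h_n\in H_n$ and a subsequence $h_{n_k}$ converges to some $h\in G$, then $h\in H$. A Chabauty limit of a closed subgroup $H\le G$ inside $G$ is a closed subgroup that is a limit in $\mathcal{S}(G)$ of a sequence of conjugates $g_nHg_n^{-1}$, $g_n\in G$. $B_F^{+}$ is the group of upper triangular matrices in $\mathrm{SL}(2,F)$. Writing $a\in F^*/(F^* )^2$ for a matrix entry means that $a\in F^*$ is a representative of a class modulo squares. *)

(* Defs.v *)
From HB Require Import structures.
From mathcomp Require Import all_boot all_order all_algebra all_field.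
From mathcomp Require Import all_classical.
From mathcomp Require Import topology.

Set Implicit Arguments.
Unset Strict Implicit.
Unset Printing Implicit Defensive.

Import Order.TTheory GRing.Theory.

(** Z_p is the projective limit of the Z/p^n: an element is the sequence of its
    residues [x n < p ^ n] modulo [p ^ n]. *)

Record padic_int (p : nat) (hp : prime p) := PadicInt {
  residue :> nat -> nat;
  _ : forall n, residue n = residue n.+1 %% p ^ n }.

Section PadicIntegers.
Variables (p : nat) (hp : prime p).
Local Notation Zp := (padic_int hp).
Implicit Types x y z : Zp.

HB.instance Definition _ := gen_eqMixin Zp.
HB.instance Definition _ := gen_choiceMixin Zp.

Let pn_gt0 n : 0 < p ^ n. Proof. by rewrite expn_gt0 prime_gt0. Qed.

Lemma residueS x n : x n = x n.+1 %% p ^ n.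
Proof. by case: x. Qed.

Lemma residue_lt x n : x n < p ^ n.
Proof. by rewrite residueS ltn_mod. Qed.

Lemma residue_mod x n : x n %% p ^ n = x n.
Proof. by rewrite modn_small ?residue_lt. Qed.

Lemma residueD x n m : x n = x (m + n) %% p ^ n.
Proof.
elim: m => [|m IHm]; first by rewrite residue_mod.
rewrite IHm addSn (residueS x (m + n)) modn_dvdm //.
by rewrite dvdn_exp2l ?leq_addl.
Qed.

Lemma padic_int_inj x y : (forall n, x n = y n) -> x = y.
Proof.
case: x y => [x hx] [y hy] /= /funext exy; rewrite -{}exy in hy *.
by congr PadicInt; apply: Prop_irrelevance.
Qed.

Definition padic_int_of (f : nat -> nat) (hf : forall n, f n = f n.+1 %[mod p ^ n])
  : Zp.
Proof.
exists (fun n => f n %% p ^ n) => n.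
by rewrite modn_dvdm ?hf // dvdn_exp2l.
Defined.

Fact padic_add_subproof x y n : x n + y n = x n.+1 + y n.+1 %[mod p ^ n].
Proof. by rewrite (residueS x) (residueS y) modnDm. Qed.

Fact padic_mul_subproof x y n : x n * y n = x n.+1 * y n.+1 %[mod p ^ n].
Proof. by rewrite (residueS x) (residueS y) modnMm. Qed.

Fact padic_opp_subproof x n :
  p ^ n - x n = p ^ n.+1 - x n.+1 %[mod p ^ n].
Proof.
apply/eqP; rewrite -(eqn_modDr (x n.+1)) subnK ?(ltnW (residue_lt x n.+1)) //.
rewrite -modnDmr -residueS subnK ?(ltnW (residue_lt x n)) //.
by rewrite modnn expnS modnMl.
Qed.

Definition padic_zero : Zp := padic_int_of (fun n => erefl (0 %% p ^ n)).
Definition padic_one : Zp := padic_int_of (fun n => erefl (1 %% p ^ n)).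
Definition padic_add x y : Zp := padic_int_of (padic_add_subproof x y).
Definition padic_mul x y : Zp := padic_int_of (padic_mul_subproof x y).
Definition padic_opp x : Zp := padic_int_of (padic_opp_subproof x).

Fact padic_addA : associative padic_add.
Proof.
by move=> x y z; apply: padic_int_inj => n /=; rewrite modnDmr modnDml addnA.
Qed.

Fact padic_addC : commutative padic_add.
Proof. by move=> x y; apply: padic_int_inj => n /=; rewrite addnC. Qed.

Fact padic_add0 : left_id padic_zero padic_add.
Proof. by move=> x; apply: padic_int_inj => n /=; rewrite mod0n residue_mod. Qed.

Fact padic_addN : left_inverse padic_zero padic_opp padic_add.
Proof.
move=> x; apply: padic_int_inj => n /=.
by rewrite modnDml subnK ?modnn ?mod0n // ltnW ?residue_lt.
Qed.

HB.instance Definition _ :=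
  GRing.isZmodule.Build Zp padic_addA padic_addC padic_add0 padic_addN.

Fact padic_mulA : associative padic_mul.
Proof.
by move=> x y z; apply: padic_int_inj => n /=; rewrite modnMmr modnMml mulnA.
Qed.

Fact padic_mulC : commutative padic_mul.
Proof. by move=> x y; apply: padic_int_inj => n /=; rewrite mulnC. Qed.

Fact padic_mul1 : left_id padic_one padic_mul.
Proof.
by move=> x; apply: padic_int_inj => n /=; rewrite modnMml mul1n residue_mod.
Qed.

Fact padic_mulDl : left_distributive padic_mul padic_add.
Proof.
move=> x y z; apply: padic_int_inj => n /=.
by rewrite modnMml modnDm mulnDl.
Qed.

Fact padic_1neq0 : padic_one != padic_zero.
Proof.
apply/eqP => /(congr1 (fun x : Zp => x 1)) /=.
by rewrite expn1 mod0n modn_small ?prime_gt1.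
Qed.

HB.instance Definition _ := GRing.Zmodule_isComNzRing.Build Zp
  padic_mulA padic_mulC padic_mul1 padic_mulDl padic_1neq0.

Local Open Scope ring_scope.

Definition padic_unit : {pred Zp} := [pred x | `[< exists y : Zp, y * x = 1 >]].

Definition padic_int_inv x : Zp :=
  if pselect (exists y : Zp, y * x = 1) is left e then projT1 (cid e) else x.

Fact padic_mulVx : {in padic_unit, left_inverse 1 padic_int_inv *%R}.
Proof.
move=> x /asboolP ex; rewrite /padic_int_inv.
by case: pselect => // e; case: (cid e).
Qed.

Fact padic_unitPl (x y : Zp) : y * x = 1 -> padic_unit x.
Proof. by move=> yx1; apply/asboolP; exists y. Qed.

Fact padic_inv_out : {in [predC padic_unit], padic_int_inv =1 id}.
Proof.
move=> x /asboolP nex; rewrite /padic_int_inv.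
by case: pselect.
Qed.

HB.instance Definition _ := GRing.ComNzRing_hasMulInverse.Build Zp
  padic_mulVx padic_unitPl padic_inv_out.

Lemma padic_int_neq0P x : x != 0 -> exists n, x n != 0%N.
Proof.
move=> /eqP x0; apply: contrapT => /forallNP nx; apply: x0.
by apply: padic_int_inj => n /=; rewrite mod0n; apply/eqP/negPn/negP/nx.
Qed.

Fact padic_int_idomain : GRing.integral_domain_axiom Zp.
Proof.
move=> x y xy0; apply/negPn; rewrite negb_or; apply/negP.
move=> /andP[/padic_int_neq0P[n xn] /padic_int_neq0P[m ym]].
have := congr1 (fun z : Zp => z (m + n)%N) xy0 => /=; rewrite mod0n => /eqP.
apply/negP; rewrite -/(dvdn _ _).
have pr_lt (z : Zp) (k l : nat) : (z k != 0)%N ->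
    (0 < z (l + k)%N)%N /\ (logn p (z (l + k)%N) < k)%N.
  rewrite (residueD z k l) -/(dvdn _ _) => zk.
  have z0 : (0 < z (l + k)%N)%N by case: posnP zk => // ->; rewrite dvdn0.
  by split=> //; rewrite ltnNge -pfactor_dvdn.
have [x0 lx] := pr_lt x n m xn; have [y0 ly] := pr_lt y m n ym.
rewrite (addnC n m) in y0 ly.
rewrite pfactor_dvdn ?muln_gt0 ?x0 // -ltnNge lognM //.
by rewrite (addnC (logn _ _)) -addSn leq_add // ltnW.
Qed.

HB.instance Definition _ :=
  GRing.ComUnitRing_isIntegral.Build Zp padic_int_idomain.

End PadicIntegers.

(** Q_p with its p-adic topology: the subgroups p^n Z_p form a fundamental
    system of neighbourhoods of 0. *)

Definition padic (p : nat) (hp : prime p) : Type := {fraction padic_int hp}.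

Section Padic.
Variables (p : nat) (hp : prime p).
Local Notation Zp := (padic_int hp).
Local Notation Qp := (padic hp).
Local Open Scope ring_scope.
Local Open Scope classical_set_scope.

HB.instance Definition _ := GRing.Field.on Qp.

Definition padic_ideal (n : nat) : set Qp :=
  [set p%:R ^+ n * (tofrac z : Qp) | z in [set: Zp]].

Lemma padic_idealN n x : padic_ideal n x -> padic_ideal n (- x).
Proof. by move=> [z _ <-]; exists (- z); rewrite // rmorphN mulrN. Qed.

Lemma padic_idealD n x y :
  padic_ideal n x -> padic_ideal n y -> padic_ideal n (x + y).
Proof.
by move=> [z _ <-] [t _ <-]; exists (z + t); rewrite // rmorphD mulrDr.
Qed.

Lemma padic_idealS m n : (m <= n)%N -> padic_ideal n `<=` padic_ideal m.
Proof.
move=> /subnKC <- _ [z _ <-]; exists (p%:R ^+ (n - m) * z) => //.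
by rewrite rmorphM rmorphXn rmorph_nat exprD mulrA.
Qed.

Definition padic_ent : set_system (Qp * Qp) :=
  filter_from setT (fun n => [set xy | padic_ideal n (xy.1 - xy.2)]).

Fact padic_ent_filter : Filter padic_ent.
Proof.
apply: filter_from_filter => [|m n _ _]; first by exists 0%N.
exists (maxn m n) => // xy /= hxy.
by split; apply: padic_idealS hxy; rewrite (leq_maxl, leq_maxr).
Qed.

Fact padic_ent_diagonal A : padic_ent A -> diagonal `<=` A.
Proof.
move=> [n _ nA] xy /= exy; apply: nA => /=; rewrite exy subrr.
by exists 0; rewrite // rmorph0 mulr0.
Qed.

Fact padic_ent_inv A : padic_ent A -> padic_ent (A^-1)%relation.
Proof.
move=> [n _ nA]; exists n => // -[x y] /= hxy; apply: nA => /=.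
by rewrite -opprB; apply: padic_idealN.
Qed.

Fact padic_ent_split A : padic_ent A ->
  exists2 B, padic_ent B & (B \; B `<=` A)%relation.
Proof.
move=> [n _ nA]; exists [set xy | padic_ideal n (xy.1 - xy.2)]; first by exists n.
move=> [x y] [z /= xz zy]; apply: nA => /=.
by rewrite -(subrKA z); apply: padic_idealD.
Qed.

HB.instance Definition _ := isUniform.Build Qp
  padic_ent_filter padic_ent_diagonal padic_ent_inv padic_ent_split.

End Padic.

(** A finite extension of Q_p has the topology of a finite-dimensional vector
    space over Q_p: that of the coordinates in a basis, which is the same for
    all bases. *)

Definition ext_coord (K : fieldType) (L : fieldExtType K) (x : L) :
    'rV[K]_(\dim {:L}) :=
  \row_i coord (vbasis {:L}) i x.

HB.instance Definition _ (p : nat) (hp : prime p) (F : fieldExtType (padic hp)) :=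
  Uniform.copy (F : Type) (initial_topology (@ext_coord (padic hp) F)).

#[short(type="preTopologicalGroupType")]
HB.structure Definition PreTopologicalGroup :=
  {G of Topological G & Group G}.

Section SL2.
Variable R : comUnitRingType.
Local Open Scope ring_scope.

Record SL2 := MkSL2 { SL2val :> 'M[R]_2; _ : \det SL2val == 1 }.

HB.instance Definition _ := [isSub for SL2val].
HB.instance Definition _ := [Choice of SL2 by <:].

Fact SL2_one_subproof : \det (1%:M : 'M[R]_2) == 1.
Proof. by rewrite det1. Qed.

Fact SL2_mul_subproof (g h : SL2) : \det ((g : 'M[R]_2) *m h) == 1.
Proof. by case: g h => [g /eqP hg] [h /eqP hh] /=; rewrite det_mulmx hg hh mulr1. Qed.

Fact SL2_inv_subproof (g : SL2) : \det (invmx (g : 'M[R]_2)) == 1.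
Proof. by case: g => [g /eqP hg] /=; rewrite det_inv hg invr1. Qed.

Definition SL2_one := MkSL2 SL2_one_subproof.
Definition SL2_mul g h := MkSL2 (SL2_mul_subproof g h).
Definition SL2_inv g := MkSL2 (SL2_inv_subproof g).

Lemma SL2_unit (g : SL2) : (g : 'M[R]_2) \in unitmx.
Proof. by case: g => [g /eqP hg] /=; rewrite unitmxE hg unitr1. Qed.

Fact SL2_mulA : associative SL2_mul.
Proof. by move=> g h k; apply: val_inj; rewrite /= mulmxA. Qed.
Fact SL2_mul1 : left_id SL2_one SL2_mul.
Proof. by move=> g; apply: val_inj; rewrite /= mul1mx. Qed.
Fact SL2_mulr1 : right_id SL2_one SL2_mul.
Proof. by move=> g; apply: val_inj; rewrite /= mulmx1. Qed.
Fact SL2_mulV : left_inverse SL2_one SL2_inv SL2_mul.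
Proof. by move=> g; apply: val_inj; rewrite /= mulVmx ?SL2_unit. Qed.
Fact SL2_mulrV : right_inverse SL2_one SL2_inv SL2_mul.
Proof. by move=> g; apply: val_inj; rewrite /= mulmxV ?SL2_unit. Qed.

HB.instance Definition _ :=
  isGroup.Build SL2 SL2_mulA SL2_mul1 SL2_mulr1 SL2_mulV SL2_mulrV.

End SL2.

HB.instance Definition _ (p : nat) (hp : prime p) (F : fieldExtType (padic hp)) :=
  Uniform.copy (SL2 F) (initial_topology (@SL2val F)).

Local Open Scope classical_set_scope.

Definition conj_set (G : groupType) (g : G) (H : set G) : set G :=
  [set (g * h * g^-1)%g | h in H].

Definition closed_subgroup (G : preTopologicalGroupType) (H : set G) : Prop :=
  group_closed (mem H) /\ closed H.

(** Sequential form of the Chabauty topology on closed subgroups; it determines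
    the convergence of sequences when the group is metrizable, as [SL2 F] is
    for [F] a finite extension of Q_p. *)
Definition chabauty_cvg (G : topologicalType) (H : nat -> set G) (L : set G) : Prop :=
  (forall h, L h ->
     exists2 u : nat -> G, (forall n, H n (u n)) & u @ \oo --> h) /\
  (forall (u : nat -> G) (k : nat -> nat) (h : G), (forall n, H n (u n)) ->
     {homo k : m n / (m < n)%N} -> (u \o k) @ \oo --> h -> L h).

Definition chabauty_limit (G : preTopologicalGroupType) (H L : set G) : Prop :=
  closed_subgroup L /\
  exists g : nat -> G, chabauty_cvg (fun n => conj_set (g n) H) L.

Section Subgroups.
Variable F : fieldType.
Implicit Types (a x y mu : F) (g : SL2 F) (M : 'M[F]_2).
Local Open Scope ring_scope.

Definition mx2 (b c d e : F) : 'M[F]_2 :=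
  \matrix_(i < 2, j < 2)
    if i == 0 then if j == 0 then b else c else if j == 0 then d else e.

Lemma mx2E M : M = mx2 (M 0 0) (M 0 1) (M 1 0) (M 1 1).
Proof.
apply/matrixP => -[[|[|//]] ?] [[|[|//]] ?]; rewrite mxE /=;
by congr (M _ _); apply: val_inj.
Qed.

Lemma mx2_inj b c d e b' c' d' e' :
  mx2 b c d e = mx2 b' c' d' e' -> [/\ b = b', c = c', d = d' & e = e'].
Proof.
move=> /matrixP E.
by move: (E 0 0) (E 0 1) (E 1 0) (E 1 1); rewrite !mxE.
Qed.

Lemma mul_mx2 b c d e b' c' d' e' : mx2 b c d e *m mx2 b' c' d' e' =
  mx2 (b * b' + c * d') (b * c' + c * e') (d * b' + e * d') (d * c' + e * e').
Proof.
apply/matrixP => i j; rewrite !mxE !big_ord_recl big_ord0 !mxE /= addr0.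
by case: (i == 0); case: (j == 0).
Qed.

Lemma det_mx2 b c d e : \det (mx2 b c d e) = b * e - c * d.
Proof.
rewrite (expand_det_row _ 0) !big_ord_recl big_ord0 addr0 !mxE /=.
by rewrite /cofactor !det_mx11 !mxE /= expr0 expr1 mul1r mulN1r mulrN.
Qed.

Definition H_theta a : set (SL2 F) :=
  [set g | exists x y, x ^+ 2 - a * y ^+ 2 = 1 /\ g = mx2 x y (a * y) x :> 'M[F]_2].

Definition theta a M : 'M[F]_2 := mx2 0 1 a 0 *m M *m invmx (mx2 0 1 a 0).

Lemma H_thetaE a : a != 0 -> H_theta a = [set g : SL2 F | theta a g = g].
Proof.
move=> a0; have Au : mx2 0 1 a 0 \in unitmx.
  by rewrite unitmxE det_mx2 mul0r mul1r sub0r unitrN unitfE.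
apply/seteqP; split=> g /=.
- move=> [x [y [_ gE]]]; apply: (canLR (mulmxK Au)); rewrite gE !mul_mx2.
  by rewrite !mul0r !mul1r !mulr0 !mulr1 !add0r !addr0 (mulrC y) (mulrC a x).
- move=> /(canRL (mulmxKV Au)); rewrite [g : 'M__]mx2E.
  set x := (g : 'M__) 0 0; set y := (g : 'M__) 0 1.
  rewrite !mul_mx2 !mul0r !mul1r !mulr0 !mulr1 !add0r !addr0.
  move=> /mx2_inj[z_eq w_eq _ _]; exists x, y.
  have gE : g = mx2 x y (a * y) x :> 'M[F]_2.
    by rewrite [LHS]mx2E -/x -/y z_eq w_eq mulrC.
  split=> //; have := valP g; rewrite /= gE det_mx2 => /eqP <-.
  by rewrite !expr2 mulrCA.
Qed.

Definition borel : set (SL2 F) := [set g | (g : 'M[F]_2) 1 0 = 0].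

Definition mu2_unipotent : set (SL2 F) :=
  [set g | exists x mu, 2.-unity_root mu /\ g = mu *: mx2 1 x 0 1 :> 'M[F]_2].

Lemma mu2_unipotent_borel : mu2_unipotent `<=` borel.
Proof. by move=> g [x [mu [_ gE]]]; rewrite /borel /= gE !mxE mulr0. Qed.

End Subgroups.

(* Main.v *)
Require Import Defs.
From mathcomp Require Import all_boot all_order all_algebra cyclic all_field.
From mathcomp Require Import all_classical.
From mathcomp Require Import topology.
From mathcomp Require Import ring.

Set Implicit Arguments.
Unset Strict Implicit.
Unset Printing Implicit Defensive.

Import Order.TTheory GRing.Theory.

(** Let A be the matrix [mx2 0 1 a 0], so that A^2 = a and A has trace 0. The
    group H = [H_theta a] consists of the matrices x + y A with x^2 - a y^2 = 1,
    and its conjugate by g of the matrices x + y X with X = g A g^-1 ([axis],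
    [conj_set_H_theta]). A sequence of conjugates of H is therefore a sequence
    of matrices X_n with X_n^2 = a and trace 0, and its Chabauty limit is read
    off from the behaviour of X_n.

    The analytic input is sequential compactness: after extraction, either X_n
    converges to some W, or there are scalars c_n tending to 0 such that c_n X_n
    converges to some W <> 0 ([mx_seq_dichotomy]). It comes from the
    compactness of Z_p, transported to matrices over F by coordinates.

    If X_n converges to W, the limit group is the set of x + y W with
    x^2 - a y^2 = 1 ([bounded_limit]). The orbit of A under SL(2, F) is closed,
    because X belongs to it as soon as the binary quadratic form det (X v | v)
    represents 1: this passes to the limit when the representing vectors stay
    bounded, and when they do not the limit form is isotropic, hence universal
    ([limit_axis]). The limit group is thus a conjugate of H.

    If c_n X_n converges to W <> 0 with c_n -> 0, then W^2 = lim c_n^2 a = 0. In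
    a convergent sequence x_n + y_n X_n of elements of the groups, y_n has to
    tend to 0, so x_n^2 tends to 1, and the limit group is that of the matrices
    mu + s W with mu^2 = 1 ([unbounded_limit]). As W is nilpotent, it is
    conjugate under SL(2, F) to a multiple of an elementary matrix
    ([nilpotent_conjugate]), which turns this group into [mu2_unipotent]. *)

(** * Divisibility by powers of p in Z_p *)

Section PadicIntegerDivisibility.
Variables (p : nat) (hp : prime p).
Local Notation Zp := (padic_int hp).
Implicit Types x y z : Zp.
Local Open Scope ring_scope.

Lemma residue0 n : (0 : Zp) n = 0%N.
Proof. by rewrite /= mod0n. Qed.

Lemma residueM x y n : (x * y) n = ((x n * y n) %% p ^ n)%N.
Proof. by []. Qed.

Lemma residue_add x y n : (x + y) n = ((x n + y n) %% p ^ n)%N.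
Proof. by []. Qed.

Lemma residue_nat k n : (k%:R : Zp) n = (k %% p ^ n)%N.
Proof.
elim: k => [|k IHk]; first by rewrite residue0 mod0n.
by rewrite mulrS residue_add IHk /= modnDm.
Qed.

Lemma residue_at0 x : x 0 = 0%N.
Proof. by have := residue_lt x 0; rewrite expn0; case: (x 0). Qed.

(** Euler's theorem inverts each residue by a power; the inverses modulo
    successive powers of p are compatible because inverses are unique. *)
Lemma padic_unit_inv x : x 1%N != 0%N -> exists y, y * x = 1.
Proof.
move=> x1; have cox n : coprime (x n) (p ^ n).
  case: n => [|n]; first by rewrite expn0 coprimen1.
  rewrite coprimeXr // coprime_sym prime_coprime //.
  have := residueD x 1 n; rewrite addn1 expn1 => xE.
  by move: x1; rewrite xE.
pose f n := (x n ^ (totient (p ^ n)).-1)%N.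
have fV n : (f n * x n = 1 %[mod p ^ n])%N.
  rewrite -expnSr prednK ?totient_gt0 ?expn_gt0 ?prime_gt0 //.
  exact: Euler_exp_totient.
have fS n : (f n = f n.+1 %[mod p ^ n])%N.
  have fVS : (f n.+1 * x n = 1 %[mod p ^ n])%N.
    have dv : (p ^ n %| p ^ n.+1)%N by rewrite dvdn_exp2l.
    rewrite (residueS x) modnMmr -(modn_dvdm _ dv) fV.
    by rewrite modn_dvdm.
  rewrite -[f n in LHS]muln1 -modnMmr -fVS modnMmr mulnC -mulnA (mulnC (x n)).
  by rewrite -modnMmr fV modnMmr muln1.
exists (padic_int_of hp fS); apply: padic_int_inj => n.
by rewrite residueM /= modnMml fV.
Qed.

Lemma residue_eq0_dvd x m : x m = 0%N -> exists y, x = p%:R ^+ m * y.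
Proof.
move=> xm; have pm0 : (0 < p ^ m)%N by rewrite expn_gt0 prime_gt0.
have dvx n : (p ^ m %| x (n + m))%N.
  by rewrite /dvdn -(residueD x m n) xm.
have yS n : ((x (n + m) %/ p ^ m) = (x (n.+1 + m) %/ p ^ m) %[mod p ^ n])%N.
  rewrite (residueS x (n + m)) -addSn.
  have := divn_eq (x (n.+1 + m)) (p ^ (n + m)).
  set q := (_ %/ p ^ (n + m))%N; set r := (_ %% p ^ (n + m))%N => ->.
  by rewrite expnD mulnA divnMDl // modnMDl.
exists (padic_int_of hp yS); apply: padic_int_inj => n.
rewrite residueM -natrX residue_nat /= modnMmr modnMml.
by rewrite mulnC divnK // addnC -residueD.
Qed.

(** The first nonzero residue of x reveals its valuation: up to a unit, x is
    the corresponding power of p. *)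
Lemma padic_int_pfactor x : x != 0 -> exists m y, y * x = p%:R ^+ m.
Proof.
move=> /padic_int_neq0P xn0; pose n := ex_minn xn0.
have : x n != 0%N by rewrite /n; case: ex_minnP.
have nmin m : x m != 0%N -> (n <= m)%N 
  by rewrite /n; case: ex_minnP => ? _; apply.
case: n nmin => [|n] nmin xn; first by rewrite residue_at0 in xn.
have /residue_eq0_dvd [y xE] : x n = 0%N.
  by apply/eqP; apply: contraT => /nmin; rewrite ltnn.
have /padic_unit_inv [z zy] : y 1%N != 0%N.
  apply: contra xn => /eqP /residue_eq0_dvd [t yE]; apply/eqP.
  rewrite xE yE mulrA -exprD addn1 residueM -natrX residue_nat modnn.
  by rewrite mul0n mod0n.
by exists n, z; rewrite xE mulrCA zy mulr1.
Qed.

End PadicIntegerDivisibility.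

(** * The ideals p^n Z_p of Q_p *)

Section PadicIdeals.
Variables (p : nat) (hp : prime p).
Local Notation Zp := (padic_int hp).
Local Notation Qp := (padic hp).
Implicit Types q r : Qp.
Local Open Scope ring_scope.
Local Notation pQ := (p%:R : Qp).
Local Open Scope classical_set_scope.

Lemma padic_natr_neq0 k : (0 < k)%N -> k%:R != 0 :> Qp.
Proof.
move=> k0; rewrite -(rmorph_nat (@tofrac Zp)) tofrac_eq0.
apply/eqP => /(congr1 (fun x : Zp => x k)); rewrite residue_nat [RHS]residue0.
rewrite modn_small; last exact: ltn_expl (prime_gt1 hp).
by move: k0 => /[swap] ->.
Qed.

Lemma padic_p_neq0 : pQ != 0.
Proof. by rewrite padic_natr_neq0 ?prime_gt0. Qed.

Lemma padic_idealM m n q r :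
  padic_ideal m q -> padic_ideal n r -> padic_ideal (m + n) (q * r).
Proof.
by move=> [x _ <-] [y _ <-]; exists (x * y); rewrite // rmorphM exprD mulrACA.
Qed.

Lemma padic_idealX m n q :
  padic_ideal (m + n) (pQ ^+ m * q) <-> padic_ideal n q.
Proof.
split=> -[x _ xE]; exists x => //.
  by apply: (mulfI (expf_neq0 m padic_p_neq0)); rewrite mulrA -exprD.
by rewrite -xE mulrA exprD.
Qed.

Lemma fraction_quotient (R : idomainType) (q : {fraction R}) :
  exists n d, d != 0 /\ tofrac d * q = tofrac n.
Proof.
elim/quotP: q => f _; exists (frac f).1, (frac f).2; split.
  exact: denom_ratioP.
unlock FracField.tofrac; rewrite -[LHS]FracField.pi_mul.
apply/eqmodP; rewrite /= FracField.equivfE /FracField.mulf.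
have d0 := denom_ratioP f.
by rewrite !numden_Ratio ?mul1r ?mulr1 ?oner_neq0 // mulrC.
Qed.

Lemma padic_bounded q : exists m, padic_ideal 0 (pQ ^+ m * q).
Proof.
have [x [y [y0 yq]]] := fraction_quotient q.
have [m [z zy]] := padic_int_pfactor y0.
exists m, (z * x) => //; rewrite expr0 mul1r tofracM -[tofrac x]yq mulrA.
congr (_ * _); rewrite -(rmorph_nat (@tofrac Zp)) -tofracXn -zy.
by rewrite [RHS]tofracM.
Qed.

Lemma padic_separated q : (forall n, padic_ideal n q) -> q = 0.
Proof.
move=> qn; have [x _ qE] := qn 0%N; rewrite -qE expr0 mul1r.
suff -> : x = 0 by rewrite tofrac0.
apply: padic_int_inj => n; have [y _ yE] := qn n.
have -> : x = p%:R ^+ n * y.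
  apply/eqP; rewrite -tofrac_eq tofracM tofracXn (rmorph_nat (@tofrac Zp)).
  by rewrite yE -qE expr0 mul1r.
by rewrite residueM -natrX residue_nat modnn mul0n.
Qed.

End PadicIdeals.


(** * Subsequences *)

Section Subsequences.
Local Open Scope classical_set_scope.

Definition increasing (k : nat -> nat) := {homo k : m n / m < n}.

Lemma increasing_comp k l : increasing k -> increasing l -> increasing (k \o l).
Proof. by move=> hk hl m n mn; apply/hk/hl. Qed.

Lemma increasing_addn N : increasing (addn N).
Proof. by move=> m n mn; rewrite ltn_add2l. Qed.

Lemma increasing_ge k : increasing k -> forall n, n <= k n.
Proof.
move=> hk; elim=> [//|n IHn]; apply: leq_ltn_trans IHn _; exact: hk.
Qed.

Lemma increasing_inj k : increasing k -> injective k.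
Proof.
move=> hk m n kmn; apply/eqP; case: ltngtP => // /hk; rewrite kmn ltnn //.
Qed.

Lemma cvg_subseq (T : topologicalType) (u : nat -> T) (l : T) (k : nat -> nat) :
  increasing k -> u @ \oo --> l -> (u \o k) @ \oo --> l.
Proof.
move=> hk ul; apply: cvg_comp ul => A [N _ NA].
exists N => // n /= Nn; apply: NA => /=.
exact: leq_trans Nn (increasing_ge hk n).
Qed.

Definition unbounded (S : set nat) := forall m, exists n, m <= n /\ S n.

Lemma unbounded_pigeonhole (T : finType) (f : nat -> T) (S : set nat) :
  unbounded S -> exists t, unbounded (S `&` [set n | f n = t]).
Proof.
move=> unbS; apply: contrapT => /forallNP noT.
have bnd t : exists m, forall n, m <= n -> S n -> f n <> t.
  have /existsNP [m /forallNP hm] := noT t; exists m => n mn Sn fnt.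
  by apply: (hm n).
have [m hm] := choice bnd.
have [n [mn Sn]] := unbS (\max_t m t).
exact: hm (leq_trans (leq_bigmax (f n)) mn) Sn erefl.
Qed.

(** Refine the index set by the pigeonhole principle at each level j, so that
    [f j] becomes constant on it, then pick the n-th index in the n-th set. *)
Lemma diagonal_subsequence (T : nat -> finType) (f : forall j, nat -> T j) :
  exists2 k, increasing k & forall j n, j <= n -> f j (k n) = f j (k j).
Proof.
(* Conditional, so that the choice of t is a total function of S. *)
have pick j (S : set nat) : exists t : T j,
    unbounded S -> unbounded (S `&` [set n | f j n = t]).
  have [unbS|bS] := pselect (unbounded S); last by exists (f j 0).
  by have [t ht] := unbounded_pigeonhole (f j) unbS; exists t.
pose t j S := projT1 (cid (pick j S)).
pose fix S j : set nat :=
  if j is i.+1 then S i `&` [set n | f i n = t i (S i)] else setT.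
have unbS j : unbounded (S j).
  elim: j => [|j IHj] /=; first by move=> m; exists m.
  exact: projT2 (cid (pick j (S j))) IHj.
have subS i j : i <= j -> S j `<=` S i.
  move=> /subnK <-; elim: (j - i) => [//|d IHd] n [Sn _]; exact: IHd.
have [e he] := choice (fun jm : nat * nat => unbS jm.1 jm.2.+1).
pose fix k n := if n is m.+1 then e (m.+2, k m) else e (1, 0).
have Sk n : S n.+1 (k n) 
    by case: n => [|n]; [have [] := he (1, 0) | have [] := he (n.+2, k n)].
have Skj j n : j <= n -> f j (k n) = t j (S j).
  by move=> jn; have [] := subS j.+1 n.+1 jn _ (Sk n).
exists k; last by move=> j n jn; rewrite !Skj.
apply: homo_ltn => [//|n] /=; first exact: ltn_trans.
by have [] := he (n.+2, k n).
Qed.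

End Subsequences.

(** * Convergence for initial and matrix topologies *)

Section SequentialTopology.
Local Open Scope classical_set_scope.

Lemma initial_cvgP (S : choiceType) (T : topologicalType) (f : S -> T)
    (u : nat -> S) (s : S) :
  u @ \oo --> (s : initial_topology f) <-> (f \o u) @ \oo --> f s.
Proof.
split=> [us|fus].
  by apply: cvg_comp us _; exact: initial_continuous.
move=> A /= [_ [[B Bop <-] Bfs sBfA]].
by apply: filterS sBfA _; apply: fus; apply: open_nbhs_nbhs.
Qed.

Lemma mx_cvgP (T : topologicalType) r s (U : nat -> 'M[T]_(r, s))
    (V : 'M[T]_(r, s)) :
  U @ \oo --> V <-> forall i j, (fun n => U n i j) @ \oo --> V i j.
Proof.
split=> [UV i j A VA|UV A [P VP PA]].
  have : nbhs V [set M : 'M_(r, s) | A (M i j)].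
    exists (fun i' j' => if (i' == i) && (j' == j) then A else setT).
      move=> i' j'; case: ifP => [/andP[/eqP -> /eqP ->]|_] //.
      exact: filterT.
    by move=> M /(_ i j); rewrite !eqxx.
  exact: UV.
rewrite /nbhs /=; near=> n.
suff: forall i j, P i j (U n i j) by apply: PA.
near: n; apply: filter_forall => i; apply: filter_forall => j.
by apply: UV; apply: VP.
Unshelve. all: by end_near. Qed.

End SequentialTopology.


(** * Sequences in Q_p *)

Section PadicSequences.
Variables (p : nat) (hp : prime p).
Local Notation Zp := (padic_int hp).
Local Notation Qp := (padic hp).
Local Open Scope ring_scope.
Local Open Scope classical_set_scope.
Local Notation pQ := (p%:R : Qp).
Implicit Types (u v : nat -> Qp) (l : Qp).

Lemma padic_cvgP u l :
  u @ \oo --> l <-> forall j, \forall n \near \oo, padic_ideal j (u n - l).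
Proof.
split=> [ul j|ul].
  have : nbhs l [set q | padic_ideal j (q - l)].
    rewrite -nbhs_entourageE; exists [set xy | padic_ideal j (xy.1 - xy.2)].
      by exists j.
    by move=> q /xsectionP /=; rewrite -opprB => /padic_idealN; rewrite opprK.
  exact: ul.
apply/cvg_entourageP => A [j _ jA]; apply: filterS (ul j) => n ujn.
by apply: jA; rewrite /= -opprB; apply: padic_idealN.
Qed.

Lemma padic_cvg_unique u l l' : u @ \oo --> l -> u @ \oo --> l' -> l = l'.
Proof.
move=> /padic_cvgP ul /padic_cvgP ul'; apply/eqP; rewrite -subr_eq0; apply/eqP.
apply: padic_separated => j.
have [n [un un']] := filter_ex (filterI (ul j) (ul' j)).
have -> : l - l' = - (u n - l) + (u n - l') by rewrite opprB subrKA.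
by apply: padic_idealD => //; apply: padic_idealN.
Qed.

Lemma padic_cvgD u v l l' :
  u @ \oo --> l -> v @ \oo --> l' -> (fun n => u n + v n) @ \oo --> l + l'.
Proof.
move=> /padic_cvgP ul /padic_cvgP vl'; apply/padic_cvgP => j.
apply: filterS2 (ul j) (vl' j) => n un vn.
by rewrite opprD addrACA; apply: padic_idealD.
Qed.

Lemma padic_cvg_sum (I : finType) (u : I -> nat -> Qp) (l : I -> Qp) :
  (forall i, u i @ \oo --> l i) ->
  (fun n => \sum_i u i n) @ \oo --> \sum_i l i.
Proof.
move=> ul; elim: (index_enum I) => [|i s IHs].
  under eq_fun do rewrite big_nil; rewrite big_nil; exact: cvg_cst.
under eq_fun do rewrite big_cons; rewrite big_cons.
exact: padic_cvgD.
Qed.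

Lemma padic_ideal_scale q j : exists i, forall r,
  padic_ideal (hp:=hp) i r -> padic_ideal j (q * r).
Proof.
have [m qm] := padic_bounded q; exists (m + j)%N => r rm.
rewrite -(padic_idealX m) mulrA.
by rewrite -[(m + j)%N]add0n; apply: padic_idealM.
Qed.

Lemma padic_cvgM u v l l' :
  u @ \oo --> l -> v @ \oo --> l' -> (fun n => u n * v n) @ \oo --> l * l'.
Proof.
move=> /padic_cvgP ul /padic_cvgP vl'; apply/padic_cvgP => j.
have [i hi] := padic_ideal_scale l j; have [i' hi'] := padic_ideal_scale l' j.
apply: filterS2 (filterI (ul j) (ul i')) (filterI (vl' 0%N) (vl' i)).
move=> n [uj ui] [v0 vi].
have -> : u n * v n - l * l'
    = (u n - l) * (v n - l') + (l' * (u n - l) + l * (v n - l')).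
  by ring.
apply: padic_idealD; first by rewrite -[j]addn0; apply: padic_idealM.
by apply: padic_idealD; [apply: hi' | apply: hi].
Qed.

Lemma padic_ideal_residue j (x y : Zp) :
  x j = y j -> padic_ideal j (tofrac x - tofrac y : Qp).
Proof.
move=> xy; have : (x - y) j = 0%N.
  rewrite residue_add /= modnDmr -xy subnKC ?modnn //.
  by rewrite ltnW ?residue_lt.
move=> /residue_eq0_dvd [z xyz]; exists z => //.
by rewrite -tofracB xyz tofracM tofracXn (rmorph_nat (@tofrac Zp)).
Qed.

(** Z_p^J is sequentially compact: a diagonal subsequence makes every residue
    eventually constant, and the constant residues are those of the limit.
    The explicit rate is what keeps the limit of vectors outside p Z_p^J away
    from 0 in the next lemma. *)
Lemma padic_int_seq_compact (J : finType) (x : nat -> J -> Qp) :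
  (forall n i, padic_ideal 0 (x n i)) ->
  exists2 k, increasing k & exists l : J -> Qp,
    forall j n i, (j <= n)%N -> padic_ideal j (x (k n) i - l i).
Proof.
move=> x0.
have xz (ni : nat * J) : exists z : Zp, tofrac z = x ni.1 ni.2.
  by have [z _ <-] := x0 ni.1 ni.2; exists z; rewrite expr0 mul1r.
have [z hz] := choice xz.
pose f j n : {ffun J -> 'I_(p ^ j)} :=
  [ffun i => Ordinal (residue_lt (z (n, i)) j)].
have [k hk fk] := diagonal_subsequence f.
have zk j n i : (j <= n)%N -> z (k n, i) j = z (k j, i) j.
  by move=> /fk /ffunP /(_ i); rewrite !ffunE => -[].
have lS i j : (z (k j, i) j = z (k j.+1, i) j.+1 %[mod p ^ j])%N.
  by rewrite -residueS residue_mod zk.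
exists k => //; exists (fun i => tofrac (padic_int_of hp (lS i))) => j n i jn.
rewrite -[x _ _](hz (k n, i)); apply: padic_ideal_residue.
by rewrite /= residue_mod zk.
Qed.

(** Local compactness of Q_p^J, together with the compactness of its projective
    space. Let [v n] be the least v such that p^v x_n is integral. If v is
    bounded along a subsequence, the x_n are bounded there and converge up to
    extraction. Otherwise v tends to infinity, and the vectors p^v x_n lie in
    the compact set of integral vectors; they are not divisible by p, so neither
    is their limit, which is therefore nonzero. *)
Lemma padic_seq_dichotomy (J : finType) (x : nat -> J -> Qp) :
  exists2 k, increasing k & exists (m : nat -> nat) (l : J -> Qp),
    (forall i, (fun n => pQ ^+ m n * x (k n) i) @ \oo --> l i) /\
    ((forall n, m n = 0%N) \/
     ((exists i, l i != 0) /\ (fun n => pQ ^+ m n) @ \oo --> (0 : Qp))).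
Proof.
have cvg_rate (u : nat -> Qp) l :
    (forall j n, (j <= n)%N -> padic_ideal j (u n - l)) -> u @ \oo --> l.
  by move=> ul; apply/padic_cvgP => j; exists j => // n /=; apply: ul.
have bnd n : exists m, `[< forall i, padic_ideal 0 (pQ ^+ m * x n i) >].
  have [m hm] := choice (fun i => padic_bounded (x n i)).
  exists (\max_i m i)%N; apply/asboolP => i.
  rewrite -(subnK (leq_bigmax i)) exprD -mulrA.
  apply: (@padic_idealS _ _ 0 (\max_i m i - m i + 0)) => //.
  by apply/padic_idealX.
pose v n := ex_minn (bnd n).
have vP n i : padic_ideal 0 (pQ ^+ v n * x n i).
  by rewrite /v; case: ex_minnP => m /asboolP.
have vmin n m : (forall i, padic_ideal 0 (pQ ^+ m * x n i)) -> (v n <= m)%N.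
  by rewrite /v => ?; case: ex_minnP => ? _; apply; apply/asboolP.
have [[M vM]|vbig] := pselect (exists M, unbounded [set n | (v n <= M)%N]).
  have [e he] := choice vM.
  pose fix k0 n := if n is n'.+1 then e (k0 n').+1 else e 0%N.
  have hk0 : increasing k0.
    apply: homo_ltn => [//|n] /=; first exact: ltn_trans.
    by have [] := he (k0 n).+1.
  have vk0 n : (v (k0 n) <= M)%N.
    by case: n => [|n] /=; [have [] := he 0%N | have [] := he (k0 n).+1].
  have [|k hk [l hl]] :=
      @padic_int_seq_compact J (fun n i => pQ ^+ M * x (k0 n) i).
    move=> n i; rewrite -(subnK (vk0 n)) exprD -mulrA.
    apply: (@padic_idealS _ _ 0 (M - v (k0 n) + 0)) => //.
    by apply/padic_idealX.
  exists (k0 \o k); first exact: increasing_comp.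
  exists (fun=> 0%N), (fun i => pQ ^- M * l i); split; last by left.
  move=> i; under eq_fun do rewrite expr0 mul1r.
  have -> : (fun n => x ((k0 \o k) n) i)
      = (fun n => pQ ^- M * (pQ ^+ M * x (k0 (k n)) i)).
    by apply: funext => n; rewrite mulKf // expf_neq0 // padic_p_neq0.
  apply: padic_cvgM; first exact: cvg_cst.
  by apply: cvg_rate => j n jn; apply: hl.
have {}vbig M : exists N, forall n, (N <= n)%N -> (M < v n)%N.
  apply: contrapT => /forallNP vN; apply: vbig; exists M => N.
  have /existsNP [n /not_implyP [Nn /negP]] := vN N.
  by rewrite -leqNgt => vn; exists n.
have [k hk [l hl]] := padic_int_seq_compact vP.
exists k => //; exists (v \o k), l; split.
  by move=> i; apply: cvg_rate => j n jn; apply: hl.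
right; split; last first.
  apply/padic_cvgP => j; have [N vN] := vbig j.
  exists N => // n /= Nn; rewrite subr0.
  have /ltnW /subnKC <- := vN (k n) (leq_trans Nn (increasing_ge hk n)).
  rewrite exprD -[X in padic_ideal X]addn0; apply/padic_idealX.
  exists (p%:R ^+ (v (k n) - j)) => //.
  by rewrite expr0 mul1r tofracXn (rmorph_nat (@tofrac Zp)).
apply: contrapT => /forallNP l0.
have [N vN] := vbig 0%N; pose n := N.+1.
have v0 : (0 < v (k n))%N.
  by apply: vN; apply: leq_trans (increasing_ge hk n).
(* If l = 0, then p^(v - 1) x_n is already integral, against minimality of v. *)
suff : (v (k n) <= (v (k n)).-1)%N by case: (v _) v0 => //= ?; rewrite ltnn.
apply: vmin => i; apply/(padic_idealX 1); rewrite mulrA -exprS prednK //.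
have /negP/negPn/eqP li := l0 i.
by have := hl 1%N n i isT; rewrite li subr0.
Qed.

End PadicSequences.


(** * Sequences in a finite extension of Q_p and in its matrix spaces *)

Section ExtensionTopology.
Variables (p : nat) (hp : prime p) (F : fieldExtType (padic hp)).
Local Notation Qp := (padic hp).
Local Open Scope ring_scope.
Local Open Scope classical_set_scope.
Local Notation cd := (coord (vbasis {:F})).
Implicit Types (u v : nat -> F) (l : F).

Lemma ext_cvgP u l :
  u @ \oo --> l <-> forall i, (fun n => cd i (u n)) @ \oo --> cd i l.
Proof.
split=> [/initial_cvgP /mx_cvgP ul i|ul].
  by have := ul 0 i; rewrite mxE; under eq_fun do rewrite /= mxE.
apply/initial_cvgP/mx_cvgP => i j; rewrite mxE.
by under eq_fun do rewrite /= mxE; apply: ul.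
Qed.

Lemma coord_inj (x y : F) : (forall i, cd i x = cd i y) -> x = y.
Proof.
move=> xy; rewrite (coord_vbasis (memvf x)) (coord_vbasis (memvf y)).
by apply: eq_bigr => i _; rewrite xy.
Qed.

Lemma ext_cvg_unique u l l' : u @ \oo --> l -> u @ \oo --> l' -> l = l'.
Proof.
move=> /ext_cvgP ul /ext_cvgP ul'; apply: coord_inj => i.
exact: padic_cvg_unique (ul i) (ul' i).
Qed.

Lemma ext_cvgD u v l l' :
  u @ \oo --> l -> v @ \oo --> l' -> (fun n => u n + v n) @ \oo --> l + l'.
Proof.
move=> /ext_cvgP ul /ext_cvgP vl'; apply/ext_cvgP => i; rewrite linearD.
by under eq_fun do rewrite linearD; apply: padic_cvgD (ul i) (vl' i).
Qed.

Lemma ext_cvg_sum (I : finType) (u : I -> nat -> F) (l : I -> F) :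
  (forall i, u i @ \oo --> l i) ->
  (fun n => \sum_i u i n) @ \oo --> \sum_i l i.
Proof.
move=> ul; elim: (index_enum I) => [|i s IHs].
  under eq_fun do rewrite big_nil; rewrite big_nil; exact: cvg_cst.
under eq_fun do rewrite big_cons; rewrite big_cons.
exact: ext_cvgD.
Qed.

(** Multiplication is bilinear in the coordinates, whence its continuity. *)
Lemma coordM i (x y : F) : cd i (x * y) =
  \sum_j \sum_k cd j x * cd k y * cd i ((vbasis {:F})`_j * (vbasis {:F})`_k).
Proof.
rewrite {1}(coord_vbasis (memvf x)) {1}(coord_vbasis (memvf y)).
rewrite big_distrl linear_sum; apply: eq_bigr => j _.
rewrite big_distrr linear_sum; apply: eq_bigr => k _.
by rewrite /= -scalerAl -scalerAr !linearZ /= mulrA.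
Qed.

Lemma ext_cvgM u v l l' :
  u @ \oo --> l -> v @ \oo --> l' -> (fun n => u n * v n) @ \oo --> l * l'.
Proof.
move=> /ext_cvgP ul /ext_cvgP vl'; apply/ext_cvgP => i; rewrite coordM.
under eq_fun do rewrite coordM.
apply: padic_cvg_sum => j; apply: padic_cvg_sum => k.
by apply: padic_cvgM; [apply: padic_cvgM (ul j) (vl' k) | apply: cvg_cst].
Qed.

Lemma ext_cvgZ (c : nat -> Qp) (c0 : Qp) l :
  c @ \oo --> c0 -> (fun n => c n *: l) @ \oo --> c0 *: l.
Proof.
move=> cc0; apply/ext_cvgP => i; rewrite linearZ.
under eq_fun do rewrite linearZ.
by apply: padic_cvgM => //; apply: cvg_cst.
Qed.

Section Matrices.
Variables r s : nat.
Implicit Types (U V : nat -> 'M[F]_(r, s)) (A B : 'M[F]_(r, s)).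

Lemma mx_cvg_unique U A B : U @ \oo --> A -> U @ \oo --> B -> A = B.
Proof.
move=> /mx_cvgP UA /mx_cvgP UB; apply/matrixP => i j.
exact: ext_cvg_unique (UA i j) (UB i j).
Qed.

Lemma mx_cvgD U V A B :
  U @ \oo --> A -> V @ \oo --> B -> (fun n => U n + V n) @ \oo --> A + B.
Proof.
move=> /mx_cvgP UA /mx_cvgP VB; apply/mx_cvgP => i j; rewrite mxE.
by under eq_fun do rewrite mxE; apply: ext_cvgD (UA i j) (VB i j).
Qed.

Lemma mx_cvgZ u U l A :
  u @ \oo --> l -> U @ \oo --> A -> (fun n => u n *: U n) @ \oo --> l *: A.
Proof.
move=> ul /mx_cvgP UA; apply/mx_cvgP => i j; rewrite mxE.
by under eq_fun do rewrite mxE; apply: ext_cvgM ul (UA i j).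
Qed.

Lemma mx_cvgB U V A B :
  U @ \oo --> A -> V @ \oo --> B -> (fun n => U n - V n) @ \oo --> A - B.
Proof.
move=> UA VB; under eq_fun do rewrite -[- V _]scaleN1r; rewrite -[- B]scaleN1r.
by apply: mx_cvgD => //; apply: mx_cvgZ => //; apply: cvg_cst.
Qed.

(** The dichotomy for Q_p^J applied to all the coordinates of all the entries;
    the scalars [c n] are powers of p. *)
Lemma mx_seq_dichotomy (X : nat -> 'M[F]_(r, s)) :
  exists2 k, increasing k & exists (c : nat -> F) (W : 'M[F]_(r, s)),
    (fun n => c n *: X (k n)) @ \oo --> W /\
    ((forall n, c n = 1) \/ (W != 0 /\ c @ \oo --> (0 : F))).
Proof.
pose J := ('I_r * 'I_s * 'I_(\dim {:F}))%type.
have [k hk [m [l [hl ml]]]] :=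
  padic_seq_dichotomy (fun n (ijh : J) => cd ijh.2 (X n ijh.1.1 ijh.1.2)).
have lE (ij : 'I_r * 'I_s) : exists w : F, forall h, cd h w = l (ij, h).
  exists (\sum_h l (ij, h) *: (vbasis {:F})`_h) => h.
  have fb : free (vbasis {:F}) by apply: basis_free; apply: vbasisP.
  by rewrite coord_sum_free.
have [w hw] := choice lE.
exists k => //.
exists (fun n => (p%:R ^+ m n : Qp) *: 1), (\matrix_(i, j) w (i, j)); split.
  apply/mx_cvgP => i j; rewrite mxE; apply/ext_cvgP => h; rewrite hw.
  under eq_fun do rewrite mxE -scalerAl mul1r linearZ.
  exact: (hl (i, j, h)).
case: ml => [m0|[[[ij h] lijh] c0]]; [left=> n|right; split].
- by rewrite m0 expr0 scale1r.
- apply: contraNneq lijh => /matrixP /(_ ij.1 ij.2); rewrite !mxE.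
  rewrite -surjective_pairing; by move=> w0; rewrite -hw w0 linear0.
- by rewrite -[0 : F](scale0r (1 : F)); apply: ext_cvgZ.
Qed.

End Matrices.

Lemma mx_cvgM r s t (U : nat -> 'M[F]_(r, s)) (V : nat -> 'M[F]_(s, t))
    (A : 'M[F]_(r, s)) (B : 'M[F]_(s, t)) :
  U @ \oo --> A -> V @ \oo --> B -> (fun n => U n *m V n) @ \oo --> A *m B.
Proof.
move=> /mx_cvgP UA /mx_cvgP VB; apply/mx_cvgP => i j; rewrite mxE.
under eq_fun do rewrite mxE.
by apply: ext_cvg_sum => k; apply: ext_cvgM (UA i k) (VB k j).
Qed.

Lemma scalar_mx_cvg r u l :
  u @ \oo --> l -> (fun n => (u n)%:M : 'M[F]_r) @ \oo --> (l%:M : 'M[F]_r).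
Proof.
move=> ul; rewrite -[l%:M]scalemx1.
under eq_fun do rewrite -[_%:M]scalemx1.
by apply: mx_cvgZ => //; apply: cvg_cst.
Qed.

Lemma mxtrace_cvg r (U : nat -> 'M[F]_r) (A : 'M[F]_r) :
  U @ \oo --> A -> (fun n => \tr (U n)) @ \oo --> \tr A.
Proof. by move=> /mx_cvgP UA; apply: ext_cvg_sum => i; apply: UA. Qed.

(** If the inverses diverged, the dichotomy would give scalars c_n -> 0 with
    c_n / u_n -> w <> 0, and multiplying by u_n -> l would give l w = 0. Passing
    to a subsequence is harmless for Chabauty limits. *)
Lemma ext_cvgV u l : u @ \oo --> l -> l != 0 ->
  exists2 k, increasing k &
    (forall n, u (k n) != 0) /\ (fun n => (u (k n))^-1) @ \oo --> l^-1.
Proof.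
move=> ul l0.
have [N _ uN] : \forall n \near \oo, u n != 0.
  have /existsNP [i li] : ~ forall i, cd i l = cd i 0.
    by move=> /coord_inj /eqP; apply/negP.
  have /existsNP [j lj] : ~ forall j, padic_ideal j (cd i l).
    by move=> /padic_separated; move: li; rewrite linear0.
  have /ext_cvgP /(_ i) /padic_cvgP /(_ j) := ul.
  apply: filterS => n unl; apply: contra_notN lj => /eqP un0.
  by move: unl; rewrite un0 linear0 sub0r => /padic_idealN; rewrite opprK.
have uN0 n : u (N + n)%N != 0 by apply: uN; rewrite /= leq_addr.
have [k hk [c [W [cW WP]]]] :=
  mx_seq_dichotomy (fun n => (u (N + n)%N)^-1%:M : 'M[F]_1).
have incNk : increasing (fun n => N + k n)%N.
  exact: increasing_comp (increasing_addn N) hk.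
exists (fun n => N + k n)%N => //; split=> [n|]; first exact: uN0.
have /(_ 0 0) cW0 : forall i j, _ := (mx_cvgP _ _).1 cW.
have cu : c @ \oo --> l * W 0 0.
  have -> : c = fun n =>
      u (N + k n)%N * (c n *: (u (N + k n)%N)^-1%:M : 'M_1) 0 0.
    by apply: funext => n; rewrite !mxE /= mulrCA mulfV // mulr1.
  by apply: ext_cvgM => //; apply: cvg_subseq ul.
case: WP => [c1|[W0 c0]].
  have cE : c = fun=> 1 by apply: funext.
  have lW : l * W 0 0 = 1.
    by apply: ext_cvg_unique cu _; rewrite cE; apply: cvg_cst.
  have -> : l^-1 = W 0 0 by rewrite -[LHS]mulr1 -lW mulKf.
  suff -> : (fun n => (u (N + k n)%N)^-1)
      = fun n => (c n *: (u (N + k n)%N)^-1%:M : 'M_1) 0 0 by [].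
  by apply: funext => n; rewrite !mxE c1 mul1r.
case/eqP: W0; apply/matrixP => i j; rewrite !ord1 mxE.
by apply: (mulfI l0); rewrite mulr0; apply: ext_cvg_unique cu c0.
Qed.

Lemma SL2_cvgP (u : nat -> SL2 F) (h : SL2 F) :
  u @ \oo --> h <-> (fun n => u n : 'M[F]_2) @ \oo --> (h : 'M[F]_2).
Proof. exact: initial_cvgP. Qed.

Lemma ext_natr_neq0 n : (0 < n)%N -> n%:R != 0 :> F.
Proof.
move=> n0; rewrite -[n%:R](rmorph_nat (in_alg F)) fmorph_eq0.
exact: padic_natr_neq0.
Qed.

End ExtensionTopology.


(** * Traceless 2 x 2 matrices and the subgroups they span *)

Section TracelessMatrices.
Variable F : fieldType.
Implicit Types (a b c d e x y z : F) (M N W X : 'M[F]_2).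
Implicit Types (v w : 'cV[F]_2) (g h : SL2 F).
Local Open Scope ring_scope.
Local Open Scope classical_set_scope.

Lemma scalar_mx2 x : x%:M = mx2 x 0 0 x.
Proof. by apply/matrixP => -[[|[|//]] ?] [[|[|//]] ?]; rewrite !mxE. Qed.

Lemma zero_mx2 : 0 = mx2 0 0 0 0 :> 'M[F]_2.
Proof. by apply/matrixP => i j; rewrite !mxE; case: ifP; case: ifP. Qed.

Lemma scale_mx2 x b c d e :
  x *: mx2 b c d e = mx2 (x * b) (x * c) (x * d) (x * e).
Proof. by apply/matrixP => -[[|[|//]] ?] [[|[|//]] ?]; rewrite !mxE. Qed.

Lemma add_mx2 (b c d e b' c' d' e' : F) :
  mx2 b c d e + mx2 b' c' d' e' = mx2 (b + b') (c + c') (d + d') (e + e').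
Proof. by apply/matrixP => -[[|[|//]] ?] [[|[|//]] ?]; rewrite !mxE. Qed.

Lemma mxtrace_mx2 b c d e : \tr (mx2 b c d e) = b + e.
Proof. by rewrite /mxtrace !big_ord_recl big_ord0 !mxE /= addr0. Qed.

Lemma traceless_mx2 M : \tr M = 0 ->
  exists x y z, M = mx2 x y z (- x).
Proof.
rewrite [M]mx2E mxtrace_mx2 => /eqP; rewrite addrC addr_eq0 => /eqP ->.
by exists (M 0 0), (M 0 1), (M 1 0).
Qed.

Lemma traceless_sqr x y z :
  mx2 x y z (- x) *m mx2 x y z (- x) = (x ^+ 2 + y * z)%:M.
Proof. by rewrite mul_mx2 scalar_mx2; congr mx2; ring. Qed.

Lemma scalar_mx_inj2 x y : x%:M = y%:M :> 'M[F]_2 -> x = y.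
Proof. by rewrite !scalar_mx2 => /mx2_inj[]. Qed.

Lemma det_scalar_add X a x y : \tr X = 0 -> X *m X = a%:M ->
  \det (x%:M + y *: X) = x ^+ 2 - a * y ^+ 2.
Proof.
move=> /traceless_mx2 [b [c [d ->]]].
rewrite traceless_sqr => /scalar_mx_inj2 <-.
by rewrite scalar_mx2 scale_mx2 add_mx2 det_mx2; ring.
Qed.

(** N kills the image of W, so N = 0 if W is invertible. Otherwise W is nilpotent
    and its image is a line; a nonzero traceless matrix killing a line is
    nilpotent with this line as both kernel and image, as W is, and this
    determines it up to a scalar. *)
Lemma traceless_collinear N W : \tr N = 0 -> \tr W = 0 -> W != 0 ->
  N *m W = 0 -> exists s, N = s *: W.
Proof.
move=> /traceless_mx2 [n1 [n2 [n3 ->]]] /traceless_mx2 [x [y [z ->]]] W0.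
rewrite mul_mx2 zero_mx2 => /mx2_inj [e1 e2 e3 e4].
have [x0|x0] := eqVneq x 0; last first.
  exists (n1 / x); rewrite scale_mx2; congr mx2.
  - by field.
  - by apply: (mulIf x0); rewrite mulrAC divfK //; apply/eqP;
      rewrite -subr_eq0 -oppr_eq0 -e2; apply/eqP; ring.
  - by apply: (mulIf x0); rewrite mulrAC divfK //; apply/eqP;
      rewrite -subr_eq0 -e3; apply/eqP; ring.
  - by field.
move: W0 e1 e2 e3 e4; rewrite {}x0 !mulr0 !oppr0 !mulr0 !addr0 !add0r.
have [->|y0] := eqVneq y 0.
  have [->|z0 _ /eqP] := eqVneq z 0.
    by case/eqP; rewrite zero_mx2.
  rewrite mulf_eq0 (negPf z0) orbF => /eqP -> _ /eqP.
  rewrite mulNr oppr_eq0 mulf_eq0 (negPf z0) orbF => /eqP -> _.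
  exists (n3 / z); rewrite scale_mx2 oppr0 mulr0 divfK //.
move=> _ /eqP n2z /eqP; rewrite mulf_eq0 (negPf y0) orbF => /eqP -> _ /eqP.
rewrite mulf_eq0 (negPf y0) orbF => /eqP ->.
exists (n2 / y); rewrite scale_mx2 oppr0 mulr0 divfK //.
by rewrite mulrAC (eqP n2z) mul0r.
Qed.

Definition SL2_mx2 b c d e (H : b * e - c * d = 1) : SL2 F :=
  MkSL2 (introT eqP (etrans (det_mx2 b c d e) H)).

Definition conjugate g M : 'M[F]_2 := g *m M *m invmx g.

Lemma conjugate_intertwine g M X : X *m g = g *m M -> X = conjugate g M.
Proof. by move=> Xg; rewrite /conjugate -Xg mulmxK ?SL2_unit. Qed.

Lemma conjugate_scalar_add g M x y :
  conjugate g (x%:M + y *: M) = x%:M + y *: conjugate g M.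
Proof.
rewrite /conjugate mulmxDr mulmxDl mul_mx_scalar -scalemxAl mulmxV ?SL2_unit //.
by rewrite scalemx1 -scalemxAr -scalemxAl.
Qed.

(** If v is not in the kernel of W, then (W v, v) is a basis in which W is an
    elementary matrix; one of the two standard basis vectors serves as v. *)
Lemma nilpotent_conjugate W : \tr W = 0 -> W *m W = 0 -> W != 0 ->
  exists g d, d != 0 /\ W = conjugate g (d *: mx2 0 1 0 0).
Proof.
move=> /traceless_mx2 [x [y [z ->]]] WW W0.
have xyz : x ^+ 2 + y * z = 0.
  by apply: scalar_mx_inj2; rewrite -traceless_sqr WW scalar_mx2 zero_mx2.
have yz : y * z = - x ^+ 2 by apply/eqP; rewrite -addr_eq0 addrC xyz.
have [z0|z0] := eqVneq z 0; last first.
  have gdet : x * 0 - (- z^-1) * z = 1 by field.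
  exists (SL2_mx2 gdet), (- z^-1); split; first by rewrite oppr_eq0 invr_eq0.
  apply: conjugate_intertwine; rewrite /= scale_mx2 !mul_mx2; congr mx2.
  - by rewrite yz; ring.
  - by ring.
  - by ring.
  - by field.
have x0 : x = 0 by apply/eqP; rewrite -sqrf_eq0 -oppr_eq0 -yz z0 mulr0.
have y0 : y != 0.
  by apply: contraNneq W0 => y0; rewrite x0 y0 z0 oppr0 -zero_mx2.
have gdet : y * y^-1 - 0 * (- x) = 1 by field.
exists (SL2_mx2 gdet), (y^-1); split; first by rewrite invr_eq0.
apply: conjugate_intertwine; rewrite /= scale_mx2 !mul_mx2 x0 z0.
by congr mx2; field.
Qed.

(** The group [H_theta a] consists of the elements of determinant 1 of the
    algebra spanned by 1 and the matrix [mx2 0 1 a 0], so that its conjugate by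
    g is determined by the conjugate of this matrix. *)
Definition axis a g : 'M[F]_2 := conjugate g (mx2 0 1 a 0).

Lemma axis_sqr a g : axis a g *m axis a g = a%:M.
Proof.
rewrite /axis /conjugate !mulmxA mulmxKV ?SL2_unit //.
rewrite -(mulmxA (SL2val g)) mul_mx2.
have -> : mx2 (0 * 0 + 1 * a) (0 * 1 + 1 * 0)
    (a * 0 + 0 * a) (a * 1 + 0 * 0) = a%:M.
  by rewrite scalar_mx2; congr mx2; ring.
by rewrite mul_mx_scalar -scalemxAl mulmxV ?SL2_unit // scalemx1.
Qed.

Lemma axis_trace a g : \tr (axis a g) = 0.
Proof.
rewrite /axis /conjugate mxtrace_mulC mulmxA mulVmx ?SL2_unit // mul1mx.
by rewrite mxtrace_mx2 addr0.
Qed.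

Definition torus a X : set (SL2 F) :=
  [set h | exists x y, x ^+ 2 - a * y ^+ 2 = 1 /\ h = x%:M + y *: X :> 'M[F]_2].

Lemma SL2_conj_val g h : (g * h * g^-1)%g = conjugate g h :> 'M[F]_2.
Proof. by []. Qed.

Lemma conj_set_H_theta a g : conj_set g (H_theta a) = torus a (axis a g).
Proof.
have HE x y : mx2 x y (a * y) x = x%:M + y *: mx2 0 1 a 0.
  by rewrite scalar_mx2 scale_mx2 add_mx2; congr mx2; ring.
apply/seteqP; split=> h /=.
  move=> [h' [x [y [xy h'E]]] <-]; exists x, y; split=> //.
  by rewrite SL2_conj_val h'E HE conjugate_scalar_add.
move=> [x [y [xy hE]]].
have gdet : x * x - y * (a * y) = 1 by rewrite -xy; ring.
exists (SL2_mx2 gdet); first by exists x, y.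
by apply: val_inj; rewrite [LHS]SL2_conj_val /= HE conjugate_scalar_add hE.
Qed.

(** For W nilpotent, 1 + s W runs over the one-parameter unipotent group of W. *)
Definition unipotent_pm W : set (SL2 F) :=
  [set h | exists mu s, mu ^+ 2 = 1 /\ h = mu%:M + s *: W :> 'M[F]_2].

Lemma conj_set_mu2_unipotent g d : d != 0 ->
  unipotent_pm (conjugate g (d *: mx2 0 1 0 0)) = conj_set g (@mu2_unipotent F).
Proof.
move=> d0; apply/seteqP; split=> h /=.
  move=> [mu [s [mu2 hE]]].
  have mu0 : mu != 0.
    by apply: contra_eq_neq mu2 => ->; rewrite expr0n eq_sym oner_neq0.
  have gdet : mu * mu - (s * d) * 0 = 1 by rewrite -mu2; ring.
  exists (SL2_mx2 gdet).
    exists (s * d / mu), mu; split; first by rewrite unity_rootE mu2.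
    by rewrite scale_mx2; congr mx2; field.
  apply: val_inj; rewrite [LHS]SL2_conj_val /= hE -conjugate_scalar_add.
  congr (conjugate g _); rewrite scalar_mx2 !scale_mx2 add_mx2.
  by congr mx2; ring.
move=> [h' [x [mu [mu2 h'E]]] <-]; exists mu, (mu * x / d); split.
  by apply/eqP; rewrite -unity_rootE.
rewrite SL2_conj_val -conjugate_scalar_add h'E.
congr (conjugate g _); rewrite scalar_mx2 !scale_mx2 add_mx2.
by congr mx2; field.
Qed.

(** A nondegenerate binary quadratic form that represents 0 represents 1. With b
    the polar form between the isotropic vector (s, t) and a vector (s1, t1)
    completing it to a basis of determinant 1, the Gram determinant gives
    b^2 = a, and q (u + r w) = q u + 2 r b is affine in r. *)
Lemma isotropic_universal a x y z s t : 2 != 0 :> F -> a != 0 ->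
  x ^+ 2 + y * z = a -> (s != 0) || (t != 0) ->
  y * t ^+ 2 + 2 * x * s * t - z * s ^+ 2 = 0 ->
  exists s' t', y * t' ^+ 2 + 2 * x * s' * t' - z * s' ^+ 2 = 1.
Proof.
move=> two0 a0 xyz st qw.
have [s1 [t1 ww]] : exists s1 t1, s * t1 - t * s1 = 1.
  have [s0|s0] := eqVneq s 0; last by exists 0, s^-1; field.
  by move: st; rewrite s0 eqxx => t0; exists (- t^-1), 0; field.
set q := fun s t => y * t ^+ 2 + 2 * x * s * t - z * s ^+ 2 in qw *.
pose b := y * t * t1 + x * (s * t1 + t * s1) - z * s * s1.
have b2 : b ^+ 2 = a.
  transitivity (q s t * q s1 t1 + (x ^+ 2 + y * z) * (s * t1 - t * s1) ^+ 2).
    by rewrite /b /q; ring.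
  by rewrite ww xyz /q qw; ring.
have b0 : b != 0 by rewrite -sqrf_eq0 b2.
pose r := (1 - q s1 t1) / (2 * b).
exists (s1 + r * s), (t1 + r * t).
transitivity (q s1 t1 + r * (2 * b) + r ^+ 2 * q s t).
  by rewrite /b /q; ring.
by rewrite /r divfK ?mulf_neq0 // /q qw; ring.
Qed.

(** The area det (X v | v). When it is 1, the matrix with columns X v and v is an
    element of SL(2, F) that conjugates [mx2 0 1 a 0] to X, provided X^2 = a. *)
Definition qform X v : F := (X *m v) 0 0 * v 1 0 - (X *m v) 1 0 * v 0 0.

Lemma qform_mx2 x y z v : qform (mx2 x y z (- x)) v =
  y * v 1 0 ^+ 2 + 2 * x * v 0 0 * v 1 0 - z * v 0 0 ^+ 2.
Proof.
rewrite /qform !mxE !big_ord_recl !big_ord0 !mxE /=.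
have -> : lift 0 0 = 1 :> 'I_2 by apply: val_inj.
by ring.
Qed.

Lemma qform1_axis a X : \tr X = 0 -> X *m X = a%:M ->
  (exists v, qform X v = 1) -> exists g, X = axis a g.
Proof.
move=> /traceless_mx2 [x [y [z ->]]].
rewrite traceless_sqr => /scalar_mx_inj2 <-.
move=> [v]; rewrite qform_mx2; move: (v 0 0) (v 1 0) => s t q1.
have gdet : (x * s + y * t) * t - s * (z * s - x * t) = 1 by rewrite -q1; ring.
exists (SL2_mx2 gdet); apply: conjugate_intertwine => /=.
by rewrite !mul_mx2; congr mx2; ring.
Qed.

Lemma isotropic_axis a X w : 2 != 0 :> F -> a != 0 -> \tr X = 0 ->
  X *m X = a%:M -> w != 0 -> qform X w = 0 -> exists g, X = axis a g.
Proof.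
move=> two0 a0 trX XX w0 qw; apply: qform1_axis => //.
move: trX XX qw => /traceless_mx2 [x [y [z ->]]].
rewrite traceless_sqr => /scalar_mx_inj2 xyz; rewrite qform_mx2 => qw.
have [|s [t st]] := isotropic_universal two0 a0 xyz _ qw.
  apply: contraNT w0; rewrite negb_or !negbK => /andP[/eqP w00 /eqP w10].
  apply/eqP/matrixP => i j; rewrite ord1 mxE.
  case: i => -[|[|//]] i2; [rewrite -[RHS]w00 | rewrite -[RHS]w10];
    by congr (w _ _); apply: val_inj.
by exists (\col_i if i == 0 then s else t); rewrite qform_mx2 !mxE.
Qed.

Lemma qform_axis_col a g : qform (axis a g) (col 1 g) = 1.
Proof.
rewrite /qform colE mulmxA /axis /conjugate mulmxKV ?SL2_unit //.
rewrite -colE -colE [SL2val g]mx2E mul_mx2 !mxE /=.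
have /eqP := valP g; rewrite /= {1}[SL2val g]mx2E det_mx2 => detg.
by rewrite -[RHS]detg; ring.
Qed.

Lemma qformZ c X v : qform X (c *: v) = c ^+ 2 * qform X v.
Proof. by rewrite /qform -scalemxAr !mxE; ring. Qed.

End TracelessMatrices.


(** * Limits of conjugates of the torus *)

(** A sequence given only along a subsequence of the subgroups extends to all of
    them by arbitrary elements, which is what the definition asks for. *)
Lemma chabauty_cvg_subseq (G : topologicalType) (H : nat -> set G) (L : set G)
    (k : nat -> nat) (v : nat -> G) (h : G) :
  chabauty_cvg H L -> (forall n, exists x, H n x) -> increasing k ->
  (forall n, H (k n) (v n)) -> (v @ \oo --> h)%classic -> L h.
Proof.
move=> [_ HL] H0 hk Hv vh.
have ext n : exists x, H n x /\ forall m, k m = n -> x = v m.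
  have [[m <-]|nk] := pselect (exists m, k m = n).
    by exists (v m); split=> // m' /(increasing_inj hk) ->.
  have [x Hx] := H0 n; exists x; split=> // m km.
  by case: nk; exists m.
have [u hu] := choice ext.
apply: (HL u k) => //; first by move=> n; have [] := hu n.
suff -> : u \o k = v by [].
by apply: funext => n; have [_] := hu (k n); apply.
Qed.

Section TorusLimits.
Variables (p : nat) (hp : prime p) (F : fieldExtType (padic hp)).
Variables (a : F) (g : nat -> SL2 F) (L : set (SL2 F)).
Local Open Scope ring_scope.
Local Open Scope classical_set_scope.
Hypothesis a0 : a != 0.
Hypothesis HL : chabauty_cvg (fun n => conj_set (g n) (H_theta a)) L.
Local Notation X := (fun n => axis a (g n)).

Let two0 : 2 != 0 :> F. Proof. exact: ext_natr_neq0. Qed.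

Lemma half_trace x y (Y : 'M[F]_2) : \tr Y = 0 ->
  \tr (x%:M + y *: Y) / 2 = x.
Proof.
move=> Y0; rewrite mxtraceD mxtraceZ Y0 mulr0 addr0 mxtrace_scalar.
by rewrite -[x *+ 2]mulr_natl mulrC mulKf.
Qed.

Lemma limit_traceless k c (W : 'M[F]_2) :
  (fun n => c n *: X (k n)) @ \oo --> W -> \tr W = 0.
Proof.
move=> /mxtrace_cvg cW; apply: ext_cvg_unique cW _.
under eq_fun do rewrite mxtraceZ axis_trace mulr0; exact: cvg_cst.
Qed.

(** The bounded case is c = 1; when c_n -> 0 the limit W is nilpotent. *)
Lemma limit_sqr k c (c0 : F) (W : 'M[F]_2) : c @ \oo --> c0 ->
  (fun n => c n *: X (k n)) @ \oo --> W -> W *m W = (c0 ^+ 2 * a)%:M.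
Proof.
move=> cc0 cW; apply: mx_cvg_unique (mx_cvgM cW cW) _.
under eq_fun do
  rewrite -scalemxAl -scalemxAr axis_sqr scalerA -expr2 scale_scalar_mx.
apply: scalar_mx_cvg.
apply: ext_cvgM; last exact: cvg_cst.
exact: ext_cvgM.
Qed.

Lemma limit_traceless_sqr k (W : 'M[F]_2) :
  (fun n => X (k n)) @ \oo --> W -> \tr W = 0 /\ W *m W = a%:M.
Proof.
move=> XW.
have XW1 : (fun n => 1 *: X (k n)) @ \oo --> W.
  by under eq_fun do rewrite scale1r.
split; first exact: limit_traceless XW1.
by rewrite (limit_sqr (cvg_cst (1 : F)) XW1) expr1n mul1r.
Qed.

(** The SL(2, F)-orbit of [mx2 0 1 a 0] is closed. The second column v_n of g_n
    satisfies qform (X_n, v_n) = 1. If a subsequence of the v_n converges to w,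
    then qform (W, w) = 1. Otherwise, the rescaled v_n converge to an isotropic
    vector w <> 0 of the form of W, which then represents 1 as well. *)
Lemma limit_axis k (W : 'M[F]_2) :
  (fun n => X (k n)) @ \oo --> W -> exists g0, W = axis a g0.
Proof.
move=> XW; have [trW WW] := limit_traceless_sqr XW.
have [l hl [c [w [cw wP]]]] := mx_seq_dichotomy (fun n => col 1 (g (k n))).
have qw : (fun n => c n ^+ 2) @ \oo --> qform W w.
  have Ww := mx_cvgM (cvg_subseq hl XW) cw.
  have -> : (fun n => c n ^+ 2)
     = fun n => qform (X (k (l n))) (c n *: col 1 (g (k (l n)))).
    by apply: funext => n; rewrite qformZ qform_axis_col mulr1.
  have qE (Y : 'M[F]_2) (v : 'cV[F]_2) : qform Y v =
      (Y *m v) 0 0 * v 1 0 + -1 * ((Y *m v) 1 0 * v 0 0) by rewrite mulN1r.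
  rewrite qE; under eq_fun do rewrite qE.
  apply: ext_cvgD; last (apply: ext_cvgM; first exact: cvg_cst).
    by apply: ext_cvgM; [move/mx_cvgP: Ww | move/mx_cvgP: cw]; apply.
  by apply: ext_cvgM; [move/mx_cvgP: Ww | move/mx_cvgP: cw]; apply.
case: wP => [c1|[w0 c0]].
  apply: qform1_axis => //; exists w; apply: ext_cvg_unique qw _.
  under eq_fun do rewrite c1 expr1n; exact: cvg_cst.
apply: (isotropic_axis two0 a0 trW WW w0).
by apply: ext_cvg_unique qw _; rewrite -(mulr0 0); apply: ext_cvgM.
Qed.

Lemma chabauty_of_cvg k (x y : nat -> F) (h : SL2 F) : increasing k ->
  (forall n, x n ^+ 2 - a * y n ^+ 2 = 1) ->
  (fun n => (x n)%:M + y n *: X (k n)) @ \oo --> (h : 'M[F]_2) -> L h.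
Proof.
move=> hk xy xyh.
have mem n : exists v : SL2 F, v = (x n)%:M + y n *: X (k n) :> 'M[F]_2.
  have /eqP detv : \det ((x n)%:M + y n *: X (k n)) = 1.
    by rewrite (det_scalar_add _ _ (axis_trace _ _) (axis_sqr _ _)).
  by exists (MkSL2 detv).
have [v hv] := choice mem.
apply: (chabauty_cvg_subseq (v := v) HL _ hk) => [n|n|].
- rewrite conj_set_H_theta.
  exists 1%g, 1, 0; split; first by rewrite expr1n expr0n mulr0 subr0.
  by rewrite scale0r addr0.
- by rewrite conj_set_H_theta; exists (x n), (y n).
- by apply/SL2_cvgP; under eq_fun do rewrite hv.
Qed.

Lemma cvg_of_chabauty k (h : SL2 F) : increasing k -> L h ->
  exists x y : nat -> F,
  [/\ forall n, x n ^+ 2 - a * y n ^+ 2 = 1,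
      (fun n => (x n)%:M + y n *: X (k n)) @ \oo --> (h : 'M[F]_2)
    & x @ \oo --> \tr h / 2].
Proof.
move=> hk /HL.1 [u uH /(cvg_subseq hk) /SL2_cvgP uh].
have uT n : exists xy : F * F, xy.1 ^+ 2 - a * xy.2 ^+ 2 = 1 /\
    u (k n) = xy.1%:M + xy.2 *: X (k n) :> 'M[F]_2.
  have := uH (k n); rewrite conj_set_H_theta => -[x [y [xy uE]]].
  by exists (x, y).
have [xy hxy] := choice uT.
exists (fun n => (xy n).1), (fun n => (xy n).2).
have uE : (fun n => (u \o k) n : 'M[F]_2)
    = fun n => (xy n).1%:M + (xy n).2 *: X (k n).
  by apply: funext => n; have [] := hxy n.
rewrite uE in uh; split=> // [n|]; first by have [] := hxy n.
have -> : (fun n => (xy n).1)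
    = fun n => \tr ((xy n).1%:M + (xy n).2 *: X (k n)) / 2.
  by apply: funext => n; rewrite half_trace ?axis_trace.
by apply: ext_cvgM; [apply: mxtrace_cvg | apply: cvg_cst].
Qed.

(** The coordinates of h = x + y X_n on 1 and X_n are x = tr h / 2 and
    y = tr (h X_n) / (2 a), so they converge together with h and X_n. *)
Lemma bounded_limit k (W : 'M[F]_2) : increasing k ->
  (fun n => X (k n)) @ \oo --> W -> L = torus a W.
Proof.
move=> hk XW.
have [trW WW] := limit_traceless_sqr XW.
apply/seteqP; split=> h.
  move=> /(cvg_of_chabauty hk) [x [y [xy uh xh]]].
  have yh : y @ \oo --> \tr (h *m W) / (2 * a).
    have -> : y
        = fun n => \tr (((x n)%:M + y n *: X (k n)) *m X (k n)) / (2 * a).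
      apply: funext => n; rewrite mulmxDl mul_scalar_mx -scalemxAl axis_sqr.
      rewrite mxtraceD !mxtraceZ axis_trace mxtrace_scalar mulr0 add0r.
      by rewrite -[a *+ 2]mulr_natl mulfK // mulf_neq0.
    apply: ext_cvgM; last exact: cvg_cst.
    by apply: mxtrace_cvg; apply: mx_cvgM.
  exists (\tr h / 2), (\tr (h *m W) / (2 * a)); split.
    rewrite !expr2 -mulN1r.
    set xl := \tr h / 2 in xh *; set yl := _ / (2 * a) in yh *.
    have x2y2 : (fun n => x n * x n + -1 * (a * (y n * y n)))
        @ \oo --> xl * xl + -1 * (a * (yl * yl)).
      apply: ext_cvgD; first exact: ext_cvgM.
      by do 2?[apply: ext_cvgM; first exact: cvg_cst]; apply: ext_cvgM.
    apply: ext_cvg_unique x2y2 _.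
    under eq_fun do rewrite mulN1r -!expr2 xy; exact: cvg_cst.
  apply: mx_cvg_unique uh _; apply: mx_cvgD; last exact: mx_cvgZ.
  exact: scalar_mx_cvg.
move=> [x [y [xy hE]]].
apply: (chabauty_of_cvg (x := fun=> x) (y := fun=> y) hk) => //; rewrite hE.
by apply: mx_cvgD; [apply: cvg_cst | apply: mx_cvgZ => //; apply: cvg_cst].
Qed.

(** Let h be the limit of x_n + y_n X_n, and N = h - tr h / 2 that of y_n X_n.
    Then N W is the limit of the scalars e_n = y_n c_n a, whose squares
    c_n^2 a (x_n^2 - 1) tend to 0. Hence N W = 0, N is a multiple of W, and
    det h = 1 says that tr h / 2 is a square root of 1. Conversely, mu + s W is
    approached through the rational parametrisation of the conic
    x^2 - a y^2 = 1 near (mu, 0), which avoids extracting square roots. *)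
Lemma unbounded_limit k c (W : 'M[F]_2) : increasing k ->
  (fun n => c n *: X (k n)) @ \oo --> W -> c @ \oo --> (0 : F) -> W != 0 ->
  L = unipotent_pm W.
Proof.
move=> hk cW c0 W0.
have trW : \tr W = 0 := limit_traceless cW.
have WW : W *m W = 0 by rewrite (limit_sqr c0 cW) expr0n mul0r raddf0.
have WW0 : W *m W = 0%:M by rewrite WW raddf0.
apply/seteqP; split=> h.
  move=> /(cvg_of_chabauty hk) [x [y [xy uh xh]]].
  set xl := \tr h / 2 in xh.
  pose N : 'M[F]_2 := SL2val h - xl%:M.
  have yN : (fun n => y n *: X (k n)) @ \oo --> N.
    have -> : (fun n => y n *: X (k n))
        = fun n => (x n)%:M + y n *: X (k n) - (x n)%:M.
      by apply: funext => n; rewrite addrC addKr.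
    by apply: mx_cvgB => //; apply: scalar_mx_cvg.
  pose e n := y n * c n * a.
  have eNW : (fun n => (e n)%:M) @ \oo --> N *m W.
    have -> : (fun n => (e n)%:M)
        = fun n => y n *: X (k n) *m (c n *: X (k n)).
      apply: funext => n; rewrite -scalemxAl -scalemxAr axis_sqr !scalerA.
      by rewrite scale_scalar_mx.
    exact: mx_cvgM.
  have NW : N *m W = 0.
    suff NW00 : (N *m W) 0 0 = 0.
      apply: (mx_cvg_unique eNW).
      have e0 : e @ \oo --> (0 : F).
        rewrite -NW00; have /mx_cvgP /(_ 0 0) := eNW.
        by under eq_fun do rewrite mxE mulr1n.
      by rewrite -(raddf0 (@scalar_mx F 2)); apply: scalar_mx_cvg.
    have e00 : e @ \oo --> (N *m W) 0 0.
      by have /mx_cvgP /(_ 0 0) := eNW; under eq_fun do rewrite mxE mulr1n.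
    apply/eqP; rewrite -sqrf_eq0 expr2; apply/eqP.
    apply: ext_cvg_unique (ext_cvgM e00 e00) _.
    have -> : (fun n => e n * e n)
        = fun n => c n * (c n * (a * (x n * x n + -1))).
      by apply: funext => n; rewrite -(xy n) /e; ring.
    rewrite -[0 : F](mul0r (0 * (a * (xl * xl + -1)))).
    apply: ext_cvgM => //; apply: ext_cvgM => //.
    apply: ext_cvgM; first exact: cvg_cst.
    by apply: ext_cvgD; [apply: ext_cvgM | apply: cvg_cst].
  have trN : \tr N = 0.
    by rewrite /N raddfB /= mxtrace_scalar -[xl *+ 2]mulr_natr divfK ?subrr.
  have [s Ns] := traceless_collinear trN trW W0 NW.
  have hE : h = xl%:M + s *: W :> 'M[F]_2 by rewrite -Ns /N addrC subrK.
  exists xl, s; split=> //.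
  have /eqP := valP h; rewrite /= hE (det_scalar_add _ _ trW WW0).
  by rewrite mul0r subr0.
move=> [mu [s [mu2 hE]]].
(* The parameter e on the conic makes y X_n close to 2 e X_n = s c_n X_n, which
   tends to s W. *)
pose e n := s * c n / 2.
have e0 : e @ \oo --> (0 : F).
  have -> : (0 : F) = s * 0 / 2 by rewrite mulr0 mul0r.
  apply: ext_cvgM; last exact: cvg_cst.
  by apply: ext_cvgM => //; apply: cvg_cst.
have ae0 : (fun n => a * (e n * e n)) @ \oo --> (0 : F).
  have -> : (0 : F) = a * (0 * 0) by rewrite !mulr0.
  by apply: ext_cvgM; [apply: cvg_cst | apply: ext_cvgM].
have d1 : (fun n => 1 + (-1) * (a * (e n * e n))) @ \oo --> (1 : F).
  suff : (fun n => 1 + (-1) * (a * (e n * e n))) @ \oo --> (1 + -1 * 0 : F).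
    by rewrite mulr0 addr0.
  apply: ext_cvgD; first exact: cvg_cst.
  by apply: ext_cvgM => //; apply: cvg_cst.
have [l hl [dn0 dV]] := ext_cvgV d1 (oner_neq0 F).
rewrite invr1 in dV.
pose d n := (1 + (-1) * (a * (e (l n) * e (l n)))).
pose x n := mu * ((1 + a * (e (l n) * e (l n))) * (d n)^-1).
pose y n := 2 * e (l n) * (d n)^-1.
have xy n : x n ^+ 2 - a * y n ^+ 2 = 1.
  have dn := dn0 n; rewrite /x exprMn mu2 /y /d; field.
  by have := dn; congr (_ != 0); ring.
apply: (chabauty_of_cvg (increasing_comp hk hl) xy); rewrite hE.
apply: mx_cvgD.
  apply: scalar_mx_cvg.
  have x1 : x @ \oo --> mu * ((1 + 0) * 1).
    apply: ext_cvgM; first exact: cvg_cst.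
    apply: ext_cvgM => //; apply: ext_cvgD; first exact: cvg_cst.
    exact: cvg_subseq hl ae0.
  by rewrite addr0 !mulr1 in x1.
have -> : (fun n => y n *: X (k (l n)))
    = fun n => (s * (d n)^-1) *: (c (l n) *: X (k (l n))).
  apply: funext => n; rewrite scalerA /y /e; congr (_ *: _).
  by move: (d n)^-1 => ?; field.
apply: mx_cvgZ; last exact: cvg_subseq hl cW.
by rewrite -[s in X in _ --> X]mulr1; apply: ext_cvgM => //; apply: cvg_cst.
Qed.

End TorusLimits.

Theorem theorem1p6 (p : nat) (hp : prime p) (hp2 : p != 2)
    (F : fieldExtType (padic hp)) (a : F) (ha : a != 0%R) (L : set (SL2 F)) :
  chabauty_limit (H_theta a) L ->
  (exists g : SL2 F, L = conj_set g (H_theta a)) \/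
  (exists g : SL2 F, L = conj_set g (@mu2_unipotent F)).
Proof.
move=> [_ [g HL]].
have [k hk [c [W [cW [c1|[W0 c0]]]]]] :=
  mx_seq_dichotomy (fun n => axis a (g n)).
- have XW : ((fun n => axis a (g (k n))) @ \oo --> W)%classic.
    by move: cW; under eq_fun do rewrite c1 scale1r.
  left; have [g0 Wg0] := limit_axis ha XW; exists g0.
  by rewrite (bounded_limit ha HL hk XW) conj_set_H_theta Wg0.
- right; have trW := limit_traceless cW.
  have WW : (W *m W = 0)%R by rewrite (limit_sqr c0 cW) expr0n mul0r raddf0.
  have [g0 [d [d0 Wg0]]] := nilpotent_conjugate trW WW W0; exists g0.
  by rewrite (unbounded_limit HL hk cW c0 W0) Wg0 conj_set_mu2_unipotent.
Qed.
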